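(* Let $L$ be an oriented link (given by an oriented link diagram), $X$ a finite quandle, $A$ an abelian group, $\phi$ a quandle 2-cocycle of $X$ with values in $A$, and $S\subset \mathrm{Hom}(X,X)$ a set of quandle endomorphisms of $X$. Let $\Phi_X^{\phi}(L)$ be the quandle 2-cocycle invariant and $\Phi_X^{S,\phi}(L)$ the quiver enhanced cocycle polynomial (a polynomial in the variables $s,t$), and write $\Phi_X^{f,\phi}(L)$ for $\Phi_X^{\{f\},\phi}(L)$. Then: (1) $$\Phi_X^{S,\phi}(L)=\sum_{f\in S}\Phi_X^{f,\phi}(L).$$ (2) Evaluating $\Phi_X^{S,\phi}(L)$ at $t=1$ yields $|S|\,\Phi_X^{\phi}(L)$. In particular, when $|S|=1$, $\Phi_X^{S,\phi}(L)$ evaluated at $t=1$ equals the quandle 2-cocycle invariant $\Phi_X^{\phi}(L)$. (3) If $f=\mathrm{id}_X$ is the identity endomorphism, then $\Phi_X^{f,\phi}(L)$ is the quandle 2-cocycle invariant $\Phi_X^{\phi}(L)$ with its variable $s$ replaced by $st$.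
   Context: A quandle is a set $X$ with a binary operation $\triangleright$ such that (i) $x\triangleright x=x$ for all $x\in X$; (ii) for every $y\in X$ the map $x\mapsto x\triangleright y$ is a bijection $X\to X$; (iii) $(x\triangleright y)\triangleright z=(x\triangleright z)\triangleright(y\triangleright z)$ for all $x,y,z\in X$. A quandle endomorphism of $X$ is a map $f:X\to X$ with $f(x\triangleright y)=f(x)\triangleright f(y)$; $\mathrm{Hom}(X,X)$ is the set of these. An $X$-coloring of an oriented link diagram of $L$ is an assignment of an element of $X$ to each arc such that at each crossing, when the crossing is drawn with its overstrand (colored $y$) pointing up, if $x$ is the color of the understrand arc on the right of the overstrand and $z$ the color of the understrand arc on its left, then $z=x\triangleright y$. Equivalently, it is a quandle homomorphism to $X$ from the fundamental quandle of $L$, i.e. the quandle generated by the arcs subject to these crossing relations. Let $\mathcal{C}(L,X)$ be the (finite) set of $X$-colorings of the diagram. A quandle 2-cocycle of $X$ with values in $A$ is a map $\phi:X\times X\to A$ (extended linearly) satisfying $\phi(x,x)=0$ for all $x\in X$ and $\phi(x,y)+\phi(x\triangleright y,z)=\phi(x,z)+\phi(x\triangleright z,y\triangleright z)$ for all $x,y,z\in X$. For an $X$-coloring $v$, a crossing $c$ with overstrand color $y$ and right-hand understrand color $x$ (that is, when the crossing is drawn with its overstrand pointing up, $x$ is the color of the understrand arc on the right of the overstrand) contributes $\phi(c)=\phi(x,y)$ if the crossing is positive and $\phi(c)=-\phi(x,y)$ if it is negative. The Boltzmann weight of $v$ is $\phi(v)=\sum_{c}\phi(c)\in A$, summed over all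 crossings of the diagram. The quandle 2-cocycle invariant is $\Phi_X^{\phi}(L)=\sum_{v\in\mathcal{C}(L,X)}s^{\phi(v)}$. Here and below exponents lie in $A$: $s^a$ and $t^a$ ($a\in A$) are formal symbols with $s^as^b=s^{a+b}$, $t^at^b=t^{a+b}$, $s^0=t^0=1$, and integer coefficients are used (so the polynomials live in the group rings $\mathbb{Z}[A]$ and $\mathbb{Z}[A\times A]$ respectively). Evaluating at $t=1$ means sending every $t^a$ to $1$; replacing $s$ by $st$ means sending $s^a$ to $s^at^a$. The quandle coloring quiver $\mathcal{Q}_X^S(L)$ is the directed graph (multiple edges and loops allowed) with one vertex for each $v\in\mathcal{C}(L,X)$ and, for each $f\in S$ and each vertex $v_j$, one directed edge from $v_j$ to $v_k=f(v_j)$, where $f(v_j)$ is the coloring obtained by applying $f$ to every arc color of $v_j$. Thus $\mathcal{Q}_X^S(L)$ is the union, over $f\in S$, of the edge sets of the quivers $\mathcal{Q}_X^{\{f\}}(L)$ on the common vertex set, and each vertex has out-degree $|S|$. The quiver enhanced cocycle polynomial is $\Phi_X^{S,\phi}(L)=\sum_{e}s^{\phi(v_j)}t^{\phi(v_k)}$, the sum being over all edges $e$ of $\mathcal{Q}_X^S(L)$, where $e$ is directed from vertex $v_j$ to vertex $v_k$. *)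

(* Defs.v *)
From HB Require Import structures.
From mathcomp Require Import all_boot all_order all_fingroup all_algebra.
From mathcomp Require Import finmap.
From mathcomp.multinomials Require Import monalg.

Set Implicit Arguments.
Unset Strict Implicit.
Unset Printing Implicit Defensive.

Import GRing.Theory.

Local Open Scope ring_scope.

Declare Scope quandle_scope.
Delimit Scope quandle_scope with Q.

HB.mixin Record isQuandle X := {
  qop : X -> X -> X;
  qopxx : forall x, qop x x = x;
  qop_bij : forall y, bijective (fun x => qop x y);
  qop_distr : forall x y z, qop (qop x y) z = qop (qop x z) (qop y z)
}.

#[short(type="quandleType")]
HB.structure Definition Quandle := { X of isQuandle X }.

#[short(type="finQuandleType")]
HB.structure Definition FinQuandle := { X of isQuandle X & Finite X }.

Notation "x ▷ y" := (qop x y)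
  (at level 40, left associativity) : quandle_scope.
Local Open Scope quandle_scope.

Definition is_qend (X : finQuandleType) (f : {ffun X -> X}) : bool :=
  [forall x, forall y, f (x ▷ y) == f x ▷ f y].

Definition qend (X : finQuandleType) := {f : {ffun X -> X} | is_qend f}.

Lemma qend_id_subproof (X : finQuandleType) : is_qend [ffun x : X => x].
Proof. by apply/forallP => x; apply/forallP => y; rewrite !ffunE. Qed.

Definition qend_id (X : finQuandleType) : qend X :=
  exist (@is_qend X) _ (qend_id_subproof X).

Definition quandle_cocycle (X : quandleType) (A : zmodType)
    (phi : X -> X -> A) : Prop :=
  (forall x, phi x x = 0) /\
  (forall x y z, phi x y + phi (x ▷ y) z = phi x z + phi (x ▷ z) (y ▷ z)).

(* A diagram is recorded as an oriented 4-valent graph on the sphere.  At a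
   crossing c there are two oriented strands, (c, over) and (c, under).
   [link_next (c, b) = (c', b')] means that on leaving c along the strand b,
   the next crossing met is c', entered along the strand b'.
   [link_circle] indexes the components without crossings. *)
Notation over := true (only parsing).
Notation under := false (only parsing).

Section Faces.
Variables (C : finType) (pos : pred C) (next : {perm C * bool}).

(* A half-edge (c, b, o) is the end at c of the strand b which points out of c
   if o is true and into c otherwise. *)
Definition half_edge : finType := (C * bool * bool)%type.

Definition half_edge_flip (d : half_edge) : half_edge :=
  let: (c, b, o) := d in
  if o then (next (c, b), false) else ((next^-1)%g (c, b), true).

(* Next half-edge counterclockwise around c.  With the overstrand pointing up,
   the order is over-out, left under, over-in, right under, and the understrand
   runs from right to left exactly when the crossing is positive. *)
Definition half_edge_turn (d : half_edge) : half_edge :=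
  let: (c, b, o) := d in
  if b == over then (c, under, o == pos c) else (c, over, o != pos c).

Definition crossing_adj : rel C :=
  [rel c c' | [exists b, ((next (c, b)).1 == c') || ((next (c', b)).1 == c)]].

(* Euler's formula V - E + F = 2 * #components: every connected component of
   the 4-valent graph is drawn on a sphere. *)
Definition spherical : bool :=
  (#|C| + fcard (half_edge_turn \o half_edge_flip) predT ==
     #|C|.*2 + (n_comp crossing_adj predT).*2)%N.

End Faces.

Record link_diagram := LinkDiagram {
  crossing : finType;
  link_circle : finType;
  positive : pred crossing;
  link_next : {perm crossing * bool};
  link_spherical : spherical positive link_next
}.

Section Arcs.
Variable L : link_diagram.

(* [inl (c, b)] is the piece of the link leaving c along b, up to the next
   crossing met, whether over or under. *)
Definition semiarc : finType := ((crossing L * bool) + link_circle L)%type.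

Definition semiarc_out (c : crossing L) (b : bool) : semiarc := inl (c, b).
Definition semiarc_in (c : crossing L) (b : bool) : semiarc :=
  inl (((link_next L)^-1)%g (c, b)).

Definition same_arc : rel semiarc :=
  connect [rel e e' | [exists c,
    ((e == semiarc_in c over) && (e' == semiarc_out c over)) ||
    ((e' == semiarc_in c over) && (e == semiarc_out c over))]].

(* An arc is a class of semiarcs joined through overcrossings. *)
Definition arc_class (e : semiarc) : {set semiarc} := [set e' | same_arc e e'].
Definition is_arc (a : {set semiarc}) : bool := [exists e, a == arc_class e].
Definition arc := {a : {set semiarc} | is_arc a}.

Lemma arc_of_subproof (e : semiarc) : is_arc (arc_class e).
Proof. by apply/existsP; exists e. Qed.

Definition arc_of (e : semiarc) : arc := exist is_arc _ (arc_of_subproof e).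

Definition over_arc (c : crossing L) : arc := arc_of (semiarc_out c over).
Definition right_arc (c : crossing L) : arc :=
  arc_of (if positive c then semiarc_in c under else semiarc_out c under).
Definition left_arc (c : crossing L) : arc :=
  arc_of (if positive c then semiarc_out c under else semiarc_in c under).

Lemma over_arcE c : arc_of (semiarc_in c over) = over_arc c.
Proof.
apply/val_inj/setP => e /=; rewrite !inE.
have sym : connect_sym [rel e e' | [exists c,
    ((e == semiarc_in c over) && (e' == semiarc_out c over)) ||
    ((e' == semiarc_in c over) && (e == semiarc_out c over))]].
  by apply: sym_connect_sym => a b /=; apply: eq_existsb => d; rewrite orbC.
by apply: (same_connect sym); apply/connect1/existsP; exists c; rewrite !eqxx.
Qed.

End Arcs.

Section Colorings.
Variables (L : link_diagram) (X : finQuandleType).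

Definition is_coloring (v : {ffun arc L -> X}) : bool :=
  [forall c, v (left_arc c) == v (right_arc c) ▷ v (over_arc c)].

Definition coloring := {v : {ffun arc L -> X} | is_coloring v}.

Lemma push_subproof (f : qend X) (v : coloring) :
  is_coloring [ffun a => val f (val v a)].
Proof.
case: f v => f /= /forallP fP [v /= /forallP vP]; apply/forallP => c.
by rewrite !ffunE (eqP (vP c)); exact/eqP/(eqP (forallP (fP _) _)).
Qed.

Definition push (f : qend X) (v : coloring) : coloring :=
  exist is_coloring _ (push_subproof f v).

Definition crossing_weight (A : zmodType) (phi : X -> X -> A) (v : coloring)
    (c : crossing L) : A :=
  let w := phi (val v (right_arc c)) (val v (over_arc c)) in
  if positive c then w else - w.

Definition boltzmann (A : zmodType) (phi : X -> X -> A) (v : coloring) : A :=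
  \sum_(c : crossing L) crossing_weight phi v c.

End Colorings.

(* [malg] has a product only when its exponents form a monoid without
   invertible elements, so the product of Z[A] is defined below. *)
Definition group_ring (A : zmodType) : Type := {malg int[A]}.
HB.instance Definition _ (A : zmodType) := GRing.Zmodule.on (group_ring A).

Definition gexp (A : zmodType) (a : A) : group_ring A := << a >>.

Section GroupRing.
Variable A : zmodType.
Implicit Types (g : group_ring A) (a b : A).

Definition gr_mul g1 g2 : group_ring A :=
  \sum_(a <- msupp g1) \sum_(b <- msupp g2) << g1@_a * g2@_b *g a + b >>.

Lemma gr_mulw (d1 d2 : {fset A}) g1 g2 :
  (msupp g1 `<=` d1)%fset -> (msupp g2 `<=` d2)%fset ->
  gr_mul g1 g2 = \sum_(a <- d1) \sum_(b <- d2) << g1@_a * g2@_b *g a + b >>.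
Proof.
move=> le_d1 le_d2; rewrite /gr_mul (big_fset_incl _ le_d1) /=.
  apply/eq_bigr=> k1 _; apply/big_fset_incl => // k _ /mcoeff_outdom ->.
  by rewrite mulr0 monalgU0.
move=> k _ /mcoeff_outdom g1k.
by rewrite big1 => // k' _; rewrite g1k mul0r monalgU0.
Qed.

Lemma gr_mulC : commutative gr_mul.
Proof.
move=> g1 g2; rewrite /gr_mul exchange_big /=.
by apply/eq_bigr=> a _; apply/eq_bigr=> b _; rewrite mulrC addrC.
Qed.

Lemma gr_mulDl : left_distributive gr_mul +%R.
Proof.
move=> g1 g2 g.
rewrite (gr_mulw (fsubsetUl (msupp g1) (msupp g2)) (fsubset_refl (msupp g))).
rewrite (gr_mulw (fsubsetUr (msupp g1) (msupp g2)) (fsubset_refl (msupp g))).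
rewrite (gr_mulw (msuppD_le g1 g2) (fsubset_refl (msupp g))).
rewrite -big_split /=; apply/eq_bigr=> k1 _.
rewrite -big_split /=; apply/eq_bigr=> k2 _.
by rewrite mcoeffD mulrDl monalgUD.
Qed.

Lemma gr_mulDr : right_distributive gr_mul +%R.
Proof. by move=> g g1 g2; rewrite !(gr_mulC g) gr_mulDl. Qed.

Lemma gr_mul0g : left_zero 0 gr_mul.
Proof. by move=> g; rewrite /gr_mul msupp0 big_seq_fset0. Qed.

Lemma gr_mulg0 : right_zero 0 gr_mul.
Proof. by move=> g; rewrite gr_mulC gr_mul0g. Qed.

Lemma gr_mulUU (c1 c2 : int) a b :
  gr_mul << c1 *g a >> << c2 *g b >> = << c1 * c2 *g a + b >>.
Proof. by rewrite (gr_mulw msuppU_le msuppU_le) !big_seq_fset1 !mcoeffUU. Qed.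

Lemma gr_ind (P : group_ring A -> Prop) :
  P 0 -> (forall g1 g2, P g1 -> P g2 -> P (g1 + g2)) ->
  (forall c a, P << c *g a >>) -> forall g, P g.
Proof. by move=> P0 PD PU g; rewrite [g]monalgE; apply: (big_ind P). Qed.

Lemma gr_mulA : associative gr_mul.
Proof.
move=> x y z; elim/gr_ind: x => [|x1 x2 h1 h2|c1 a1].
- by rewrite !gr_mul0g.
- by rewrite !gr_mulDl h1 h2.
elim/gr_ind: y => [|y1 y2 h1 h2|c2 a2].
- by rewrite !(gr_mul0g, gr_mulg0).
- by rewrite !(gr_mulDl, gr_mulDr) h1 h2.
elim/gr_ind: z => [|z1 z2 h1 h2|c3 a3].
- by rewrite !gr_mulg0.
- by rewrite !gr_mulDr h1 h2.
by rewrite !gr_mulUU mulrA addrA.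
Qed.

Lemma gr_mul1g : left_id (gexp 0) gr_mul.
Proof.
move=> x; elim/gr_ind: x => [|x1 x2 h1 h2|c a]; first exact: gr_mulg0.
  by rewrite gr_mulDr h1 h2.
by rewrite gr_mulUU mul1r add0r.
Qed.

Lemma gr_oner_neq0 : gexp 0 != 0 :> group_ring A.
Proof. by rewrite /gexp monalgU_eq0. Qed.

HB.instance Definition _ := GRing.Zmodule_isComNzRing.Build (group_ring A)
  gr_mulA gr_mulC gr_mul1g gr_mulDl gr_oner_neq0.

Lemma gexp0 : gexp 0 = 1 :> group_ring A. Proof. by []. Qed.

Lemma gexpD a b : gexp (a + b) = gexp a * gexp b.
Proof. by rewrite [RHS]gr_mulUU mulr1. Qed.

End GroupRing.

(* The Z-linear map Z[A] -> R sending the basis element a to h a; it is a ring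
   morphism as soon as h turns sums into products. *)
Definition gr_lift (A : zmodType) (R : comNzRingType) (h : A -> R) :
  group_ring A -> R := mmap intr h.

Section GroupRingLift.
Variables (A : zmodType) (R : comNzRingType) (h : A -> R).

HB.instance Definition _ := GRing.Additive.on (gr_lift h).

Lemma gr_lift_gexp a : gr_lift h (gexp a) = h a.
Proof. by rewrite /gr_lift mmapU mul1r. Qed.

Lemma gr_lift_monoid_morphism : h 0 = 1 -> {morph h : a b / a + b >-> a * b} ->
  monoid_morphism (gr_lift h).
Proof.
move=> h0 hD; split=> [|x y]; first by rewrite -gexp0 gr_lift_gexp.
elim/gr_ind: x => [|x1 x2 h1 h2|c1 a1].
- by rewrite mul0r raddf0 mul0r.
- by rewrite mulrDl !raddfD /= mulrDl h1 h2.
elim/gr_ind: y => [|y1 y2 h1 h2|c2 a2].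
- by rewrite mulr0 raddf0 mulr0.
- by rewrite mulrDr !raddfD /= mulrDr h1 h2.
by rewrite [X in gr_lift h X]gr_mulUU /gr_lift !mmapU /= hD rmorphM mulrACA.
Qed.

End GroupRingLift.

(* A polynomial in s is an element of Z[A], where s^a is [gexp a]; a polynomial
   in s and t is an element of Z[A x A], where s^a and t^b are as follows. *)
Definition sexp (A : zmodType) (a : A) : group_ring (A * A)%type := gexp (a, 0).
Definition texp (A : zmodType) (b : A) : group_ring (A * A)%type := gexp (0, b).

(* s^a t^b |-> s^a *)
Definition eval_t1 (A : zmodType) : group_ring (A * A)%type -> group_ring A :=
  gr_lift (fun ab : A * A => gexp ab.1).

(* s^a |-> s^a t^a *)
Definition subst_st (A : zmodType) : group_ring A -> group_ring (A * A)%type :=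
  gr_lift (fun a : A => sexp a * texp a).

HB.instance Definition _ A := GRing.Additive.on (@eval_t1 A).
HB.instance Definition _ A := GRing.Additive.on (@subst_st A).

Section Substitutions.
Variable A : zmodType.
Implicit Types a b : A.

Lemma sexpD a b : sexp (a + b) = sexp a * sexp b.
Proof. by rewrite -gexpD -[RHS]/(gexp (a + b, 0 + 0)) addr0. Qed.

Lemma texpD a b : texp (a + b) = texp a * texp b.
Proof. by rewrite -gexpD -[RHS]/(gexp (0 + 0, a + b)) addr0. Qed.

Lemma sexp_texp a b : sexp a * texp b = gexp (a, b).
Proof. by rewrite -gexpD -[LHS]/(gexp (a + 0, 0 + b)) addr0 add0r. Qed.

Lemma eval_t1_monoid_morphism : monoid_morphism (@eval_t1 A).
Proof. by apply: gr_lift_monoid_morphism => // x y /=; rewrite gexpD. Qed.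

HB.instance Definition _ :=
  GRing.isMonoidMorphism.Build _ _ (@eval_t1 A) eval_t1_monoid_morphism.

Lemma eval_t1_sexp a : eval_t1 (sexp a) = gexp a.
Proof. exact: gr_lift_gexp. Qed.

Lemma eval_t1_texp a : eval_t1 (texp a) = 1.
Proof. exact: gr_lift_gexp. Qed.

Lemma subst_st_monoid_morphism : monoid_morphism (@subst_st A).
Proof.
apply: gr_lift_monoid_morphism => [|x y /=]; first by rewrite sexp_texp.
by rewrite sexpD texpD mulrACA.
Qed.

HB.instance Definition _ :=
  GRing.isMonoidMorphism.Build _ _ (@subst_st A) subst_st_monoid_morphism.

Lemma subst_st_gexp a : subst_st (gexp a) = sexp a * texp a.
Proof. exact: gr_lift_gexp. Qed.

End Substitutions.

Record quiver := Quiver {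
  qvertex : finType;
  qedge : finType;
  qsource : qedge -> qvertex;
  qtarget : qedge -> qvertex
}.

Definition coloring_quiver (L : link_diagram) (X : finQuandleType)
    (S : {set qend X}) : quiver :=
  @Quiver (coloring L X) ({f : qend X | f \in S} * coloring L X)%type
    (fun e => e.2) (fun e => push (val e.1) e.2).

Definition cocycle_invariant (L : link_diagram) (X : finQuandleType)
    (A : zmodType) (phi : X -> X -> A) : group_ring A :=
  \sum_(v : coloring L X) gexp (boltzmann phi v).

Definition quiver_cocycle_poly (L : link_diagram) (X : finQuandleType)
    (A : zmodType) (S : {set qend X}) (phi : X -> X -> A) :
    group_ring (A * A)%type :=
  \sum_(e : qedge (coloring_quiver L S))
    sexp (boltzmann phi (qsource e)) * texp (boltzmann phi (qtarget e)).

(* Main.v *)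
Require Import Defs.
From mathcomp Require Import all_boot all_order all_fingroup all_algebra.

Set Implicit Arguments.
Unset Strict Implicit.
Unset Printing Implicit Defensive.

Import GRing.Theory.
Local Open Scope ring_scope.

(** An edge of the coloring quiver is a pair of an endomorphism [f] in [S] and
    a source coloring [v], so the polynomial is a double sum over [f] and [v],
    [quiver_cocycle_polyE], and it is enough to look at the inner sum for one
    [f].  Setting [t] to 1 forgets the target of an edge and leaves [v] as the
    only datum: every [f] contributes one copy of the cocycle invariant.  For
    the identity, source and target of each edge coincide, so that a coloring
    of weight [a] contributes [s^a t^a]. *)

Lemma quiver_cocycle_polyE (L : link_diagram) (X : finQuandleType)
    (A : zmodType) (phi : X -> X -> A) (S : {set qend X}) :
  quiver_cocycle_poly L S phi =
    \sum_(f in S) \sum_(v : coloring L X)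
      sexp (boltzmann phi v) * texp (boltzmann phi (push f v)).
Proof.
rewrite /quiver_cocycle_poly /=.
rewrite -(pair_bigA _ (fun (g : {f : qend X | f \in S}) (v : coloring L X) =>
  sexp (boltzmann phi v) * texp (boltzmann phi (push (val g) v)))) /=.
by rewrite [RHS]big_sub.
Qed.

Lemma eval_t1_quiver_cocycle_poly (L : link_diagram) (X : finQuandleType)
    (A : zmodType) (phi : X -> X -> A) (S : {set qend X}) :
  eval_t1 (quiver_cocycle_poly L S phi) = #|S|%:R * cocycle_invariant L phi.
Proof.
rewrite quiver_cocycle_polyE raddf_sum mulr_natl -sumr_const.
apply: eq_bigr => f _; rewrite raddf_sum; apply: eq_bigr => v _.
by rewrite /= rmorphM /= eval_t1_sexp eval_t1_texp mulr1.
Qed.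

Lemma push_id (L : link_diagram) (X : finQuandleType) (v : coloring L X) :
  push (qend_id X) v = v.
Proof. by apply/val_inj/ffunP => a; rewrite !ffunE. Qed.

Theorem mainTheorem1 (L : link_diagram) (X : finQuandleType) (A : zmodType)
    (phi : X -> X -> A) (S : {set qend X}) :
  quandle_cocycle phi ->
  [/\ quiver_cocycle_poly L S phi =
        \sum_(f in S) quiver_cocycle_poly L [set f] phi,
      eval_t1 (quiver_cocycle_poly L S phi) =
        #|S|%:R * cocycle_invariant L phi,
      #|S| = 1%N ->
        eval_t1 (quiver_cocycle_poly L S phi) = cocycle_invariant L phi
    & quiver_cocycle_poly L [set qend_id X] phi =
        subst_st (cocycle_invariant L phi)].
Proof.
move=> _; split.
- rewrite quiver_cocycle_polyE; apply: eq_bigr => f _.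
  by rewrite quiver_cocycle_polyE big_set1.
- exact: eval_t1_quiver_cocycle_poly.
- by move=> S1; rewrite eval_t1_quiver_cocycle_poly S1 mul1r.
- rewrite quiver_cocycle_polyE big_set1 raddf_sum; apply: eq_bigr => v _.
  by rewrite /= push_id subst_st_gexp.
Qed.
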